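(* A gain $\mathbf{K}=(K_0,\dots,K_{M-1})\in\mathbb{R}^{N\times Mm}$ is an optimal solution of the estimation problem (Problem 2) $$\min_{\mathbf{K}\in\mathbb{R}^{N\times Mm}}\ \mathbb{E}\Big[\mathrm{tr}\Big(\sum_{t=0}^{M-1}(x_{t+1}-\hat x_{t+1})(x_{t+1}-\hat x_{t+1})^T\,\Sigma\Big)\Big]$$ (with $\hat x_t$ generated by $\mathbf{K}$ as in the context) if and only if it is an optimal solution of the stochastic optimal control problem (Problem 3) $$\min_{\mathbf{K}\in\mathbb{R}^{N\times Mm}}\ \mathbb{E}\Big[\sum_{t=0}^{M-1}\Big(s_t^TQ_{M-t-1}s_t+u_t^T\big(CQ_{M-t-1}C^T+R_{M-t}\big)u_t+2u_t^TCQ_{M-t-1}s_t\Big)+s_M^TP_0s_M\Big]$$ subject to $s_{t+1}=A^Ts_t+(CA)^Tu_t+z_t$, $u_t=-K_{M-t-1}^Ts_t$ for $t=0,\dots,M-1$, where $s_0\sim\mathcal N(0,\Sigma)$, $z_t\sim\mathcal N(0,\Sigma)$ for $t=0,\dots,M-2$, $z_{M-1}=0$, and $s_0,z_0,\dots,z_{M-1}$ are mutually independent. That is, the optimal solution of Problem 2 is the same as that of Problem 3.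
   Context: Let $M,N,m$ be positive integers, $A\in\mathbb{R}^{N\times N}$, $C\in\mathbb{R}^{m\times N}$. The system is $x_{t+1}=Ax_t+\omega_t$, $y_t=Cx_t+v_t$, $t\in\mathbb{N}$ ($0\in\mathbb N$), where $x_0\sim\mathcal N(\bar x_0,\Sigma_{x_0})$, $\{\omega_t\}$ and $\{v_t\}$ are Gaussian random vectors with $\mathbb{E}[\omega_t]=0$, $\mathbb{E}[v_t]=0$, $\mathbb{E}[\omega_t\omega_t^T]=Q_t$, $\mathbb{E}[v_tv_t^T]=R_t$, and $x_0,\omega_t,v_t$ ($t\in\mathbb{N}$) are mutually independent. The covariance matrices $Q_t,R_t$ are positive definite. For a gain $\mathbf{K}=(K_0,\dots,K_{M-1})$ with $K_t\in\mathbb{R}^{N\times m}$, the estimates are generated by $\hat x_0=\bar x_0$ and $\hat x_{t+1}=A\hat x_t+K_tCA(x_t-\hat x_t)+K_tC\omega_t+K_tv_{t+1}$ (equivalently $\hat x_{t+1}=A\hat x_t+K_t(y_{t+1}-CA\hat x_t)$). $P_0=\mathbb{E}[(x_0-\hat x_0)(x_0-\hat x_0)^T]$ and $\Sigma=\sum_{n=1}^{N}(CA^n)^TCA^n$. *)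

(* Defs.v *)
From HB Require Import structures.
From mathcomp Require Import all_boot all_order all_algebra.
From mathcomp Require Import finmap.
From mathcomp Require Import all_classical all_reals all_analysis.
Import Order.TTheory GRing.Theory Num.Theory.
Import numFieldNormedType.Exports.

Set Implicit Arguments.
Unset Strict Implicit.
Unset Printing Implicit Defensive.

Local Open Scope classical_set_scope.
Local Open Scope ring_scope.

Definition bform (R : realType) (p q : nat)
    (x : 'cV[R]_p) (B : 'M[R]_(p, q)) (y : 'cV[R]_q) : R :=
  (x^T *m B *m y) 0 0.

Definition pos_semidef (R : realType) (n : nat) (S : 'M[R]_n) : Prop :=
  S^T = S /\ forall a : 'cV[R]_n, 0 <= bform a S a.

Definition pos_def (R : realType) (n : nat) (S : 'M[R]_n) : Prop :=
  S^T = S /\ forall a : 'cV[R]_n, a != 0 -> 0 < bform a S a.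

Section random_vectors.
Context (R : realType) (d : measure_display) (Omega : measurableType d).

Definition random_vector (n : nat) (X : Omega -> 'cV[R]_n) : Prop :=
  forall i : 'I_n, measurable_fun setT (fun o => X o i 0).

Variable P : probability Omega R.

(* 'E_P takes values in \bar R, so for X with measurable entries this also
   says that every entry is integrable. *)
Definition has_expectation (p q : nat)
    (X : Omega -> 'M[R]_(p, q)) (B : 'M[R]_(p, q)) : Prop :=
  forall i j, ('E_P[fun o => X o i j])%E = (B i j)%:E.

(* The normal law with mean mu and variance v.  The library's
   [normal_prob mu s] takes the standard deviation s, and is not the point
   mass at mu when s = 0. *)
Definition normal_law (mu v : R) (B : set R) : \bar R :=
  if v == 0 then \d_mu B else normal_prob mu (Num.sqrt v) B.

(* X ~ N(mu, S), with S possibly singular: every linear functional a^T X is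
   normal with mean a^T mu and variance a^T S a. *)
Definition normal_vector (n : nat)
    (X : Omega -> 'cV[R]_n) (mu : 'cV[R]_n) (S : 'M[R]_n) : Prop :=
  [/\ random_vector X, pos_semidef S &
      forall (a : 'cV[R]_n) (B : set R), measurable B ->
        P [set o | B ((a^T *m X o) 0 0)] =
        normal_law ((a^T *m mu) 0 0) (bform a S a) B].

Definition gaussian (n : nat) (X : Omega -> 'cV[R]_n) : Prop :=
  exists mu S, normal_vector X mu S.

Definition sigma_of (n : nat) (X : Omega -> 'cV[R]_n) : set (set Omega) :=
  g_sigma_preimage (fun (i : 'I_n) o => X o i 0).

(* Stated for sigma-algebras so that a family may mix random vectors of
   different dimensions. *)
Definition mutually_independent (I : choiceType)
    (F : I -> set (set Omega)) : Prop :=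
  forall (J : {fset I}) (E : I -> set Omega),
    (forall i, i \in J -> F i (E i)) ->
    P (\bigcap_(i in [set` J]) E i) = (\prod_(i <- J) P (E i))%E.

End random_vectors.

Definition is_minimizer (R : realType) (T : Type) (J : T -> \bar R) (K : T) :
    Prop :=
  forall K' : T, (J K <= J K')%E.

Definition SigmaCA (R : realType) (N m : nat)
    (A : 'M[R]_N) (C : 'M[R]_(m, N)) : 'M[R]_N :=
  \sum_(1 <= n < N.+1) (C *m A ^+ n)^T *m (C *m A ^+ n).

Section estimation.
Context (R : realType) (M N m : nat) (A : 'M[R]_N) (C : 'M[R]_(m, N)).
Context (Omega : Type).
Context (x0 : Omega -> 'cV[R]_N) (xbar0 : 'cV[R]_N).
Context (w : nat -> Omega -> 'cV[R]_N) (v : nat -> Omega -> 'cV[R]_m).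

Fixpoint state (t : nat) (o : Omega) : 'cV[R]_N :=
  if t is t'.+1 then A *m state t' o + w t' o else x0 o.

Definition output (t : nat) (o : Omega) : 'cV[R]_m :=
  C *m state t o + v t o.

(* K`_t is K_t for t < M, and 0 (never used in the costs) for t >= M. *)
Fixpoint estimate (K : M.-tuple 'M[R]_(N, m)) (t : nat) (o : Omega) :
    'cV[R]_N :=
  if t is t'.+1 then
    A *m estimate K t' o
    + K`_t' *m C *m A *m (state t' o - estimate K t' o)
    + K`_t' *m C *m w t' o + K`_t' *m v t'.+1 o
  else xbar0.

Lemma estimateE (K : M.-tuple 'M[R]_(N, m)) (t : nat) (o : Omega) :
  estimate K t.+1 o =
  A *m estimate K t o
  + K`_t *m (output t.+1 o - C *m A *m estimate K t o).
Proof.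
rewrite /output/= !(mulmxDr, mulmxN, mulmxA) -!addrA; do 2 congr (_ + _).
by rewrite addrC -addrA.
Qed.

Definition error (K : M.-tuple 'M[R]_(N, m)) (t : nat) (o : Omega) :
    'cV[R]_N :=
  state t o - estimate K t o.

End estimation.

Definition estimation_cost (R : realType) (M N m : nat)
    (A : 'M[R]_N) (C : 'M[R]_(m, N))
    (d : measure_display) (Omega : measurableType d) (P : probability Omega R)
    (x0 : Omega -> 'cV[R]_N) (xbar0 : 'cV[R]_N)
    (w : nat -> Omega -> 'cV[R]_N) (v : nat -> Omega -> 'cV[R]_m)
    (K : M.-tuple 'M[R]_(N, m)) : \bar R :=
  let e := error A C x0 xbar0 w v K in
  ('E_P[fun o =>
    \tr ((\sum_(t < M) e t.+1 o *m (e t.+1 o)^T) *m SigmaCA A C)%R])%E.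

Section control.
Context (R : realType) (M N m : nat) (A : 'M[R]_N) (C : 'M[R]_(m, N)).
Context (Omega : Type).
Context (s0 : Omega -> 'cV[R]_N) (z : nat -> Omega -> 'cV[R]_N).

Definition feedback (K : M.-tuple 'M[R]_(N, m)) (t : nat) (s : 'cV[R]_N) :
    'cV[R]_m :=
  - (K`_(M - t - 1))^T *m s.

Fixpoint control_state (K : M.-tuple 'M[R]_(N, m)) (t : nat) (o : Omega) :
    'cV[R]_N :=
  if t is t'.+1 then
    A^T *m control_state K t' o
    + (C *m A)^T *m feedback K t' (control_state K t' o) + z t' o
  else s0 o.

Definition control_input (K : M.-tuple 'M[R]_(N, m)) (t : nat) (o : Omega) :
    'cV[R]_m :=
  feedback K t (control_state K t o).

End control.

Definition control_cost (R : realType) (M N m : nat)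
    (A : 'M[R]_N) (C : 'M[R]_(m, N))
    (Q : nat -> 'M[R]_N) (V : nat -> 'M[R]_m) (P0 : 'M[R]_N)
    (d : measure_display) (Omega : measurableType d) (P : probability Omega R)
    (s0 : Omega -> 'cV[R]_N) (z : nat -> Omega -> 'cV[R]_N)
    (K : M.-tuple 'M[R]_(N, m)) : \bar R :=
  let s := control_state A C s0 z K in
  let u := control_input A C s0 z K in
  ('E_P[fun o =>
    ((\sum_(t < M)
      (bform (s t o) (Q (M - t - 1)%N) (s t o)
       + bform (u t o) (C *m Q (M - t - 1)%N *m C^T + V (M - t)%N) (u t o)
       + 2 * bform (u t o) (C *m Q (M - t - 1)%N) (s t o)))
    + bform (s M o) P0 (s M o))%R])%E.

Definition noise_sigma (R : realType) (N m : nat)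
    (d : measure_display) (Omega : measurableType d)
    (x0 : Omega -> 'cV[R]_N) (w : nat -> Omega -> 'cV[R]_N)
    (v : nat -> Omega -> 'cV[R]_m) (k : option (nat + nat)) :
    set (set Omega) :=
  match k with
  | None => sigma_of x0
  | Some (inl t) => sigma_of (w t)
  | Some (inr t) => sigma_of (v t)
  end.

Definition control_noise_sigma (R : realType) (M N : nat)
    (d : measure_display) (Omega : measurableType d)
    (s0 : Omega -> 'cV[R]_N) (z : nat -> Omega -> 'cV[R]_N)
    (k : option 'I_M) : set (set Omega) :=
  if k is Some t then sigma_of (z t) else sigma_of s0.

(* Main.v *)
(** Both costs are the same function of the gain [K].  With
    [F_t = (I - K_t C) A] and
    [G_t = (I - K_t C) Q_t (I - K_t C)^T + K_t V_(t+1) K_t^T], the error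
    covariances satisfy [P_(t+1) = F_t P_t F_t^T + G_t], while the second moments
    of the control state satisfy
    [S_(t+1) = F_(M-t-1)^T S_t F_(M-t-1) + Sigma] (without [Sigma] at the last
    step) and the stage cost is [tr (G_(M-t-1) S_t)].  Telescoping
    [tr (P_(M-k) S_k)] over [k] gives
    [sum_t tr (P_(t+1) Sigma) = sum_t tr (G_(M-t-1) S_t) + tr (P_0 S_M)].

    The variance of a normal law is obtained without integrating by parts:
    comparing [exp (- x^2 / 2 s^2)] with [exp (- x^2 / 2 t^2)] through
    [exp y >= 1 + y] and integrating both densities to [1] bounds the second
    moment for [s] by [t^2], from above if [t > s] and from below if [t < s]. *)
Require Import Defs.
From HB Require Import structures.
From mathcomp Require Import all_boot all_order all_algebra.
From mathcomp Require Import finmap.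
From mathcomp Require Import all_classical all_reals all_analysis.
From mathcomp Require Import measurable_realfun zify ring lra.
Import Order.TTheory GRing.Theory Num.Theory.
Import numFieldNormedType.Exports.

Set Implicit Arguments.
Unset Strict Implicit.
Unset Printing Implicit Defensive.

Local Open Scope classical_set_scope.
Local Open Scope ring_scope.

(** * Second moment of the centred normal law *)

Section normal_moments.
Context (R : realType).
Local Notation mu := lebesgue_measure.

(** Change of variables produces the Radon-Nikodym derivative of the normal law. It agrees almost
    everywhere with [normal_pdf], because both have the same integral over every measurable set. *)
Lemma ge0_integral_normal_prob (m s : R) (f : R -> \bar R) :
  measurable_fun setT f -> (forall x, 0 <= f x)%E ->
  (\int[normal_prob m s]_x f x = \int[mu]_x (f x * (normal_pdf m s x)%:E))%E.
Proof.
move=> mf f0; have dom := @normal_prob_dominates R m s.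
rewrite -(Radon_Nikodym_SigmaFinite.change_of_variables dom)//.
apply: ae_eq_integral => //.
- apply: emeasurable_funM => //; apply: (measurable_int mu).
  exact: Radon_Nikodym_SigmaFinite.f_integrable.
- apply: emeasurable_funM => //.
  by apply: measurableT_comp => //; exact: measurable_normal_pdf.
- apply: ae_eqe_mul2l; apply: integral_ae_eq => //.
  + exact: Radon_Nikodym_SigmaFinite.f_integrable.
  + by apply: measurableT_comp => //; exact: measurable_normal_pdf.
  + by move=> E _ mE; rewrite -Radon_Nikodym_SigmaFinite.f_integral.
Qed.

(** The factor [s] cancels the dependence of the normalising constant on [s], so two such densities
    can be compared through their exponentials alone. *)
Lemma mul_normal_pdf0 (s x : R) : 0 < s ->
  s * normal_pdf 0 s x =
  (Num.sqrt (pi *+ 2))^-1 * expR (- (x ^+ 2 / (s ^+ 2 *+ 2))).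
Proof.
move=> s0; rewrite normal_pdfE ?gt_eqF// /normal_peak /normal_fun subr0 mulNr.
rewrite -mulrnAr sqrtrM ?sqr_ge0// sqrtr_sqr gtr0_norm// invfM !mulrA.
by rewrite divff ?mul1r// gt_eqF.
Qed.

(* [expR y >= 1 + y] at [y = x ^+ 2 / (2 s ^+ 2) - x ^+ 2 / (2 t ^+ 2)] *)
Lemma normal_pdf0_tangent (s t x : R) : 0 < s -> 0 < t ->
  s * normal_pdf 0 s x * (1 + ((s ^+ 2 *+ 2)^-1 - (t ^+ 2 *+ 2)^-1) * x ^+ 2) <=
  t * normal_pdf 0 t x.
Proof.
move=> s0 t0; rewrite !mul_normal_pdf0// -mulrA ler_wpM2l ?invr_ge0//.
set a := _^-1; set b := _^-1.
apply: (@le_trans _ _ (expR (- (x ^+ 2 * a)) * expR ((a - b) * x ^+ 2))).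
  by rewrite ler_wpM2l ?expR_ge0// expR_ge1Dx.
by rewrite -expRD ler_expR; lra.
Qed.

Local Open Scope ereal_scope.

(** Kept in the extended reals: finiteness is only known once [m2_le] is proved. *)
Let m2 (s : R) := \int[mu]_x (x ^+ 2 * normal_pdf 0 s x)%:E.

Let measurable_sqr_pdf s :
  measurable_fun setT (fun x : R => (x ^+ 2 * normal_pdf 0 s x)%R).
Proof.
by apply: measurable_funM; [exact: exprn_measurable|exact: measurable_normal_pdf].
Qed.

Let integral_mul_pdf (s c : R) : (0 <= c)%R ->
  \int[mu]_x (c * normal_pdf 0 s x)%:E = c%:E.
Proof.
move=> c0; under eq_integral do rewrite EFinM.
rewrite ge0_integralZl_EFin ?integral_normal_pdf ?mule1//.
- by move=> x _; rewrite lee_fin normal_pdf_ge0.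
- by apply: measurableT_comp => //; exact: measurable_normal_pdf.
Qed.

Let integral_mul_sqr_pdf (s c : R) : (0 <= c)%R ->
  \int[mu]_x (c * (x ^+ 2 * normal_pdf 0 s x))%:E = c%:E * m2 s.
Proof.
move=> c0; under eq_integral do rewrite EFinM.
rewrite ge0_integralZl_EFin//.
- by move=> x _; rewrite lee_fin mulr_ge0 ?sqr_ge0 ?normal_pdf_ge0.
- by apply: measurableT_comp => //; exact: measurable_sqr_pdf.
Qed.

Let measurable_mul_pdf (s c : R) :
  measurable_fun setT (fun x : R => (c * normal_pdf 0 s x)%:E).
Proof.
by apply/measurable_EFinP/measurable_funM => //; exact: measurable_normal_pdf.
Qed.

Let measurable_mul_sqr_pdf (s c : R) :
  measurable_fun setT (fun x : R => (c * (x ^+ 2 * normal_pdf 0 s x))%:E).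
Proof. exact/measurable_EFinP/measurable_funM. Qed.

(** Integrating [normal_pdf0_tangent] gives [s + s a m2(s) <= t]. Since [a] contains the factor
    [t - s], dividing by it leaves [m2(s) (t + s) <= 2 s t^2], and [2 s < t + s]. *)
Let m2_le (s t : R) : (0 < s < t)%R -> m2 s <= (t ^+ 2)%:E.
Proof.
move=> /andP[s0 st]; have t0 := lt_trans s0 st.
pose a := ((s ^+ 2 *+ 2)^-1 - (t ^+ 2 *+ 2)^-1)%R.
have aE : a = ((t - s) * (t + s) / (s ^+ 2 * t ^+ 2 *+ 2))%R.
  by rewrite /a; field; rewrite !gt_eqF.
have a0 : (0 < a)%R.
  by rewrite aE divr_gt0 ?pmulrn_lgt0 ?mulr_gt0 ?exprn_gt0 ?subr_gt0 ?addr_gt0.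
have sa0 : (0 <= s * a)%R by rewrite ltW// mulr_gt0.
have : s%:E + (s * a)%:E * m2 s <= t%:E.
  rewrite -(integral_mul_pdf s (ltW s0)) -(integral_mul_pdf t (ltW t0)).
  rewrite -integral_mul_sqr_pdf// -ge0_integralD//=; last 4 first.
  - by move=> x _; rewrite lee_fin mulr_ge0 ?normal_pdf_ge0// ltW.
  - exact: measurable_mul_pdf.
  - by move=> x _; rewrite lee_fin mulr_ge0// mulr_ge0 ?sqr_ge0 ?normal_pdf_ge0.
  - exact: measurable_mul_sqr_pdf.
  apply: ge0_le_integral => //=.
  - move=> x _; rewrite -EFinD lee_fin.
    by rewrite addr_ge0// mulr_ge0 ?normal_pdf_ge0 ?(ltW s0)// mulr_ge0 ?sqr_ge0 ?normal_pdf_ge0.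
  - apply: emeasurable_funD; [exact: measurable_mul_pdf|exact: measurable_mul_sqr_pdf].
  - exact: measurable_mul_pdf.
  - move=> x _; rewrite -EFinD lee_fin.
    apply: le_trans (normal_pdf0_tangent x s0 t0).
    by rewrite -/a le_eqVlt; apply/orP; left; apply/eqP; ring.
have m20 : 0 <= m2 s.
  by apply: integral_ge0 => x _; rewrite lee_fin mulr_ge0 ?sqr_ge0 ?normal_pdf_ge0.
(* An infinite second moment would make the left side of the bound infinite, since [s a > 0]. *)
move: m20; case: (m2 s) => [r||]; rewrite ?leye_eq//=; last first.
  by move=> _; rewrite gt0_muley ?lte_fin ?mulr_gt0// addey.
rewrite -EFinM -EFinD !lee_fin => r0 h.
have : (a * s * r <= t - s)%R by lra.
have -> : (a * s * r = (t - s) * (r * (t + s) / (s * t ^+ 2 *+ 2)))%R.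
  by rewrite aE; field; rewrite !gt_eqF.
rewrite -[leRHS]mulr1 ler_pM2l ?subr_gt0// ler_pdivrMr; last first.
  by rewrite pmulrn_lgt0 ?mulr_gt0 ?exprn_gt0.
rewrite mul1r => h'; have sts : (0 < t + s)%R by rewrite addr_gt0.
rewrite -(ler_pM2r sts); apply: le_trans h' _.
rewrite -mulrnAl mulrC ler_wpM2l ?sqr_ge0//; lra.
Qed.

(** The mirror image of [m2_le]: for [t < s] the coefficient in the tangent inequality is [- a] with
    [a > 0], and the bound becomes [2 s t^2 <= m2(s) (s + t)], where now [2 s > s + t]. *)
Let le_m2 (s t : R) : (0 < t < s)%R -> (t ^+ 2)%:E <= m2 s.
Proof.
move=> /andP[t0 ts]; have s0 := lt_trans t0 ts.
pose a := ((t ^+ 2 *+ 2)^-1 - (s ^+ 2 *+ 2)^-1)%R.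
have aE : a = ((s - t) * (s + t) / (s ^+ 2 * t ^+ 2 *+ 2))%R.
  by rewrite /a; field; rewrite !gt_eqF.
have a0 : (0 < a)%R.
  by rewrite aE divr_gt0 ?pmulrn_lgt0 ?mulr_gt0 ?exprn_gt0 ?subr_gt0 ?addr_gt0.
have sa0 : (0 <= s * a)%R by rewrite ltW// mulr_gt0.
(* The negative term is moved to the right, so that all integrands stay nonnegative. *)
have : s%:E <= t%:E + (s * a)%:E * m2 s.
  rewrite -(integral_mul_pdf s (ltW s0)) -(integral_mul_pdf t (ltW t0)).
  rewrite -integral_mul_sqr_pdf// -ge0_integralD//=; last 4 first.
  - by move=> x _; rewrite lee_fin mulr_ge0 ?normal_pdf_ge0// ltW.
  - exact: measurable_mul_pdf.
  - by move=> x _; rewrite lee_fin mulr_ge0// mulr_ge0 ?sqr_ge0 ?normal_pdf_ge0.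
  - exact: measurable_mul_sqr_pdf.
  apply: ge0_le_integral => //=.
  - by move=> x _; rewrite lee_fin mulr_ge0 ?normal_pdf_ge0// ltW.
  - exact: measurable_mul_pdf.
  - apply: emeasurable_funD; [exact: measurable_mul_pdf|exact: measurable_mul_sqr_pdf].
  - move=> x _; rewrite -EFinD lee_fin.
    have := normal_pdf0_tangent x s0 t0; rewrite -opprB -/a => h.
    rewrite -lerBlDr; apply: le_trans h.
    by rewrite le_eqVlt; apply/orP; left; apply/eqP; ring.
case: (m2 s) => [r||]; rewrite ?leey//; last first.
  by rewrite gt0_muleNy ?lte_fin ?mulr_gt0.
rewrite -EFinM -EFinD !lee_fin => h.
have : (s - t <= a * s * r)%R by lra.
have -> : (a * s * r = (s - t) * (r * (s + t) / (s * t ^+ 2 *+ 2)))%R.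
  by rewrite aE; field; rewrite !gt_eqF.
rewrite -[leLHS]mulr1 ler_pM2l ?subr_gt0// ler_pdivlMr; last first.
  by rewrite pmulrn_lgt0 ?mulr_gt0 ?exprn_gt0.
rewrite mul1r => h'; have sts : (0 < s + t)%R by rewrite addr_gt0.
rewrite -(ler_pM2r sts); apply: le_trans h'.
rewrite -mulrnAl [leRHS]mulrC ler_wpM2l ?sqr_ge0//; lra.
Qed.

Lemma normal_prob_second_moment (s : R) : (0 < s)%R ->
  \int[normal_prob 0 s]_x (x ^+ 2)%:E = (s ^+ 2)%:E.
Proof.
move=> s0; rewrite ge0_integral_normal_prob; last 2 first.
- by apply: measurableT_comp => //; exact: exprn_measurable.
- by move=> x; rewrite lee_fin sqr_ge0.
under eq_integral do rewrite -EFinM.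
rewrite -/(m2 s).
(* The instances [s / 2] and [s + 1] show that the second moment is positive and finite, so it is
   the square of some [q > 0]. *)
have /le_m2 : (0 < s / 2 < s)%R by apply/andP; split; lra.
have /m2_le : (0 < s < s + 1)%R by apply/andP; split; lra.
have := @le_m2 s; have := @m2_le s.
case: (m2 s) => [r||]; rewrite ?leye_eq ?leeNy_eq// => le1 le2 _; rewrite lee_fin => r0.
have r_gt0 : (0 < r)%R by apply: lt_le_trans r0; rewrite exprn_gt0// divr_gt0.
have rE : r = (Num.sqrt r ^+ 2)%R by rewrite sqr_sqrtr// ltW.
have q0 : (0 < Num.sqrt r)%R by rewrite sqrtr_gt0.
move: (Num.sqrt r) rE q0 => q rE q0.
congr EFin; rewrite rE; congr (_ ^+ 2)%R; apply/eqP; rewrite eq_le !leNgt.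
apply/andP; split; apply/negP => h.
(* If [q] differed from [s], the bound at their midpoint would place [q] on the wrong side of that
   midpoint. *)
- have /le1 : (0 < s < (s + q) / 2)%R by apply/andP; split; lra.
  by rewrite rE lee_fin ler_pXn2r ?nnegrE//; lra.
- have /le2 : (0 < (s + q) / 2 < s)%R by apply/andP; split; lra.
  by rewrite rE lee_fin ler_pXn2r ?nnegrE//; lra.
Qed.

End normal_moments.

(** * Means of real random variables, and products of independent ones *)

Section means.
Context (R : realType) (d : measure_display) (Omega : measurableType d).
Variable P : probability Omega R.

(** Integrability is bundled with the value, so that means can be added and scaled without side
    conditions. *)
Definition has_mean (f : Omega -> R) (c : R) :=
  P.-integrable setT (EFin \o f) /\ (\int[P]_o (f o)%:E)%E = c%:E.

(** A finite value of the integral forces the positive and negative parts to have finite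
    integrals. *)
Lemma has_meanP (f : Omega -> R) (c : R) : measurable_fun setT f ->
  (\int[P]_o (f o)%:E)%E = c%:E -> has_mean f c.
Proof.
move=> mf fc; split=> //; apply/integrableP; split; first exact/measurable_EFinP.
by rewrite integral_fin_num_abs// fc.
Qed.

Lemma has_mean_expectation (f : Omega -> R) (c : R) : has_mean f c ->
  ('E_P[f])%E = c%:E.
Proof. by rewrite unlock => -[]. Qed.

Lemma has_mean_cst (c : R) : has_mean (fun=> c) c.
Proof.
split; first exact: finite_measure_integrable_cst.
by rewrite integral_cst//= probability_setT mule1.
Qed.

Lemma has_meanD (f g : Omega -> R) (a b : R) :
  has_mean f a -> has_mean g b -> has_mean (fun o => f o + g o) (a + b).
Proof.
move=> [fi fa] [gi gb]; split; first exact: integrableD fi gi.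
under eq_integral do rewrite EFinD.
by rewrite integralD// fa gb.
Qed.

Lemma has_meanZ (k : R) (f : Omega -> R) (a : R) :
  has_mean f a -> has_mean (fun o => k * f o) (k * a).
Proof.
move=> [fi fa]; split; first exact: integrableZl fi.
under eq_integral do rewrite EFinM.
by rewrite integralZl// fa.
Qed.

Lemma has_mean_sum (I : Type) (r : seq I) (F : I -> Omega -> R) (a : I -> R) :
  (forall i, has_mean (F i) (a i)) ->
  has_mean (fun o => \sum_(i <- r) F i o) (\sum_(i <- r) a i).
Proof.
move=> Fa; elim: r => [|i r ih].
  by under eq_fun do rewrite big_nil; rewrite big_nil; exact: has_mean_cst.
by under eq_fun do rewrite big_cons; rewrite big_cons; exact: has_meanD.
Qed.

Lemma has_mean_integrable (f : Omega -> R) :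
  P.-integrable setT (EFin \o f) -> exists c, has_mean f c.
Proof.
move=> fi; exists (fine (\int[P]_o (f o)%:E)%E); split=> //.
by rewrite fineK//; exact: integrable_fin_num.
Qed.

(** Domination of [|f|] by [1 + f ^+ 2], which is integrable because [P] is finite. *)
Lemma integrable_of_sqr (f : Omega -> R) : measurable_fun setT f ->
  P.-integrable setT (fun o => (f o ^+ 2)%:E) -> P.-integrable setT (EFin \o f).
Proof.
move=> mf fi.
have i1 : P.-integrable setT (EFin \o (fun=> 1 : R)).
  exact: finite_measure_integrable_cst.
apply: le_integrable (integrableD measurableT i1 fi) => //.
  exact/measurable_EFinP.
move=> x _ /=; rewrite lee_fin [leRHS]ger0_norm ?addr_ge0 ?sqr_ge0//.
rewrite -real_normK ?num_real//; have := normr_ge0 (f x); have := sqr_ge0 (`|f x| - 1); nra.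
Qed.

Definition indep_rv (f g : Omega -> R) :=
  forall A B : set R, measurable A -> measurable B ->
    (P (f @^-1` A `&` g @^-1` B) = P (f @^-1` A) * P (g @^-1` B))%E.

(** Independence makes the law of [(f, g)] the product of the two laws, since agreement on
    rectangles determines the product measure. Fubini then factors the integral of the product. *)
Lemma has_meanM (f g : Omega -> R) (a b : R) :
  measurable_fun setT f -> measurable_fun setT g -> indep_rv f g ->
  has_mean f a -> has_mean g b -> has_mean (fun o => f o * g o) (a * b).
Proof.
move=> mf mg fg [fi fa] [gi gb].
pose X : {RV P >-> R} := HB.pack f (isMeasurableFun.Build _ _ _ _ f mf).
pose Y : {RV P >-> R} := HB.pack g (isMeasurableFun.Build _ _ _ _ g mg).
have mXY : measurable_fun setT (fun o => (f o, g o)) by exact: measurable_fun_pair.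
pose XY : {RV P >-> (R * R)%type} :=
  HB.pack (fun o => (f o, g o)) (isMeasurableFun.Build _ _ _ _ _ mXY).
pose D1 := distribution P X; pose D2 := distribution P Y.
pose D := distribution P XY.
have DE : forall A, measurable A -> (D1 \x D2)%E A = D A.
  by apply: product_measure_unique => A B mA mB; exact: fg.
pose h (u : R * R) : \bar R := (u.1 * u.2)%:E.
have mh : measurable_fun setT h.
  by apply/measurable_EFinP; apply: measurable_funM.
have id1 : D1.-integrable setT (EFin \o (id : R -> R)).
  by apply: integrable_pushforward => //; exact/measurable_EFinP.
have id2 : D2.-integrable setT (EFin \o (id : R -> R)).
  by apply: integrable_pushforward => //; exact/measurable_EFinP.
(* [c] is the first absolute moment of [g]. The iterated integral of [|x y|] is [c] times that of
   [f], which gives integrability on the product. *)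
have [c cE] : exists c : R, (\int[D2]_y `|y%:E| = c%:E)%E.
  exists (fine (\int[D2]_y `|y%:E|)%E); rewrite fineK//.
  apply: integrable_fin_num => //.
  exact: integrable_abse id2.
have hi : (D1 \x D2)%E.-integrable setT h.
  apply/integrable12ltyP => //.
  have inner (x : R) : (\int[D2]_y `|h (x, y)| = c%:E * `|x%:E|)%E.
    rewrite muleC -cE -integralZl//=; last exact: integrable_abse id2.
    by apply: eq_integral => y _; rewrite /h/= normrM EFinM.
  under eq_integral do rewrite inner.
  rewrite integralZl//; last exact: integrable_abse id1.
  rewrite lte_mul_pinfty// ?lee_fin.
    by rewrite -lee_fin -cE integral_ge0.
  by have /integrableP[] := id1.
have hE : (\int[D1 \x D2]_u h u = (a * b)%:E)%E.
  have D1a : (\int[D1]_x x%:E = a%:E)%E.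
    by rewrite -fa -[RHS](@integral_distribution _ _ _ _ _ P X EFin).
  have D2b : (\int[D2]_y y%:E = b%:E)%E.
    by rewrite -gb -[RHS](@integral_distribution _ _ _ _ _ P Y EFin).
  rewrite -integral12_prod_meas1// /fubini_F.
  have inner (x : R) : (\int[D2]_y h (x, y) = b%:E * x%:E)%E.
    by rewrite muleC -D2b -integralZl.
  under eq_integral do rewrite inner.
  by rewrite integralZl// D1a -EFinM mulrC.
(* The product measure is replaced by the joint law and pulled back to [P]. *)
have hiD : P.-integrable setT (h \o XY).
  apply/integrableP; split; first exact: measurableT_comp.
  have /integrableP[_] := hi.
  rewrite (eq_measure_integral D) => [|A mA _]; last exact: DE.
  by rewrite ge0_integral_distribution//; exact: measurableT_comp.
split; first exact: hiD.
rewrite -[LHS](@integral_distribution _ _ _ _ _ P XY h)//.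
by rewrite -hE; apply: eq_measure_integral => A mA _; apply: esym; exact: DE.
Qed.

End means.

(** * Entrywise means of random matrices, and second moments along a linear recursion *)

Section matrix_means.
Context (R : realType) (d : measure_display) (Omega : measurableType d).
Variable P : probability Omega R.

Definition has_mean_mx (p q : nat) (F : Omega -> 'M[R]_(p, q)) (B : 'M[R]_(p, q)) :=
  forall i j, has_mean P (fun o => F o i j) (B i j).

Lemma has_mean_mxP (p q : nat) (F : Omega -> 'M[R]_(p, q)) (B : 'M[R]_(p, q)) :
  (forall i j, measurable_fun setT (fun o => F o i j)) ->
  has_expectation P F B -> has_mean_mx F B.
Proof.
move=> mF FB i j; apply: has_meanP => //.
by have := FB i j; rewrite unlock.
Qed.

Lemma has_mean_mx_cst (p q : nat) (B : 'M[R]_(p, q)) : has_mean_mx (fun=> B) B.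
Proof. by move=> i j; exact: has_mean_cst. Qed.

Lemma has_mean_mxD (p q : nat) (F G : Omega -> 'M[R]_(p, q)) B C :
  has_mean_mx F B -> has_mean_mx G C -> has_mean_mx (fun o => F o + G o) (B + C).
Proof.
move=> FB GC i j; rewrite mxE; under eq_fun do rewrite mxE.
exact: has_meanD.
Qed.

Lemma has_mean_mxMl (p q r : nat) (L : 'M[R]_(r, p)) (F : Omega -> 'M[R]_(p, q)) B :
  has_mean_mx F B -> has_mean_mx (fun o => L *m F o) (L *m B).
Proof.
move=> FB i j; rewrite mxE; under eq_fun do rewrite mxE.
by apply: has_mean_sum => k; exact: has_meanZ.
Qed.

Lemma has_mean_mxT (p q : nat) (F : Omega -> 'M[R]_(p, q)) B :
  has_mean_mx F B -> has_mean_mx (fun o => (F o)^T) B^T.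
Proof. by move=> FB i j; rewrite mxE; under eq_fun do rewrite mxE. Qed.

Lemma has_mean_mxMr (p q r : nat) (L : 'M[R]_(q, r)) (F : Omega -> 'M[R]_(p, q)) B :
  has_mean_mx F B -> has_mean_mx (fun o => F o *m L) (B *m L).
Proof.
move=> /has_mean_mxT /(has_mean_mxMl L^T) /has_mean_mxT; rewrite -trmx_mul trmxK.
by under eq_fun do rewrite -trmx_mul trmxK.
Qed.

Lemma has_mean_mx_sum (p q : nat) (I : Type) (r : seq I)
    (F : I -> Omega -> 'M[R]_(p, q)) (B : I -> 'M[R]_(p, q)) :
  (forall i, has_mean_mx (F i) (B i)) ->
  has_mean_mx (fun o => \sum_(i <- r) F i o) (\sum_(i <- r) B i).
Proof.
move=> FB i j; rewrite summxE; under eq_fun do rewrite summxE.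
by apply: has_mean_sum => k; exact: FB.
Qed.

Lemma has_mean_trace (p : nat) (F : Omega -> 'M[R]_p) B :
  has_mean_mx F B -> has_mean P (fun o => \tr (F o)) (\tr B).
Proof. by move=> FB; apply: has_mean_sum. Qed.

(** One cross term suffices, the other being its transpose. *)
Lemma has_second_momentD (n : nat) (X Y : Omega -> 'cV[R]_n) B C :
  has_mean_mx (fun o => X o *m (X o)^T) B ->
  has_mean_mx (fun o => X o *m (Y o)^T) 0 ->
  has_mean_mx (fun o => Y o *m (Y o)^T) C ->
  has_mean_mx (fun o => (X o + Y o) *m (X o + Y o)^T) (B + C).
Proof.
move=> XX XY YY.
have := has_mean_mxD (has_mean_mxD (has_mean_mxD XX XY) (has_mean_mxT XY)) YY.
rewrite trmx0 !addr0; congr has_mean_mx; apply/funext => o.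
by rewrite trmx_mul trmxK linearD/= mulmxDl !mulmxDr !addrA.
Qed.

(** The diagonal of [X X^T] makes the squares of the entries integrable, hence the entries
    themselves. *)
Lemma has_second_moment_mean (n : nat) (X : Omega -> 'cV[R]_n) S :
  random_vector X -> has_mean_mx (fun o => X o *m (X o)^T) S ->
  exists b, has_mean_mx X b.
Proof.
move=> mX XS.
have Xc i : exists c, has_mean P (fun o => X o i 0) c.
  apply/has_mean_integrable/integrable_of_sqr => //.
  have [+ _] := XS i i; apply: eq_integrable => //.
  by move=> o _ /=; rewrite mxE big_ord1 mxE.
have [c cE] := choice Xc.
by exists (\col_i c i) => i j; rewrite mxE (ord1 j).
Qed.

Lemma has_mean_outer0_sym (p q : nat) (X : Omega -> 'cV[R]_p) (Y : Omega -> 'cV[R]_q) :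
  has_mean_mx (fun o => X o *m (Y o)^T) 0 -> has_mean_mx (fun o => Y o *m (X o)^T) 0.
Proof.
move=> /has_mean_mxT; rewrite trmx0; congr has_mean_mx.
by apply/funext => o; rewrite trmx_mul trmxK.
Qed.

Lemma has_mean_outer0_lin (n p q r : nat) (X : Omega -> 'cV[R]_n)
    (Y : Omega -> 'cV[R]_p) (Z : Omega -> 'cV[R]_q)
    (L : 'M[R]_(r, p)) (H : 'M[R]_(r, q)) :
  has_mean_mx (fun o => X o *m (Y o)^T) 0 ->
  has_mean_mx (fun o => X o *m (Z o)^T) 0 ->
  has_mean_mx (fun o => X o *m (L *m Y o + H *m Z o)^T) 0.
Proof.
move=> /(has_mean_mxMr L^T) XY /(has_mean_mxMr H^T) XZ.
have := has_mean_mxD XY XZ; rewrite !mul0mx addr0; congr has_mean_mx.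
apply/funext => o.
by rewrite [(L *m Y o + _)^T]linearD/= !trmx_mul mulmxDr !mulmxA.
Qed.

Lemma has_second_momentMl (n p : nat) (L : 'M[R]_(p, n)) (X : Omega -> 'cV[R]_n) B :
  has_mean_mx (fun o => X o *m (X o)^T) B ->
  has_mean_mx (fun o => (L *m X o) *m (L *m X o)^T) (L *m B *m L^T).
Proof.
move=> /(has_mean_mxMl L)/(has_mean_mxMr L^T); congr has_mean_mx.
by apply/funext => o; rewrite trmx_mul !mulmxA.
Qed.

(** The Lyapunov recursion for the second moment of [y_(t+1) = F_t y_t + eta_t], with [W_t] the
    second moment of [eta_t]. It serves both the estimation error and the control state. *)
Fixpoint lin_cov (n : nat) (F W : nat -> 'M[R]_n) (S0 : 'M[R]_n) (t : nat) : 'M[R]_n :=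
  if t is t'.+1 then F t' *m lin_cov F W S0 t' *m (F t')^T + W t' else S0.

Lemma lin_cov_second_moment (n M : nat) (F W : nat -> 'M[R]_n) (S0 : 'M[R]_n)
    (y eta : nat -> Omega -> 'cV[R]_n) :
  (forall t o, (t < M)%N -> y t.+1 o = F t *m y t o + eta t o) ->
  has_mean_mx (fun o => y 0%N o *m (y 0%N o)^T) S0 ->
  (forall t, (t < M)%N -> has_mean_mx (fun o => y 0%N o *m (eta t o)^T) 0) ->
  (forall s t, (s < t < M)%N -> has_mean_mx (fun o => eta s o *m (eta t o)^T) 0) ->
  (forall t, (t < M)%N -> has_mean_mx (fun o => eta t o *m (eta t o)^T) (W t)) ->
  forall t, (t <= M)%N -> has_mean_mx (fun o => y t o *m (y t o)^T) (lin_cov F W S0 t).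
Proof.
move=> yE y00 y0eta etaeta etaW.
(* [y_t] is built from [y_0] and the noises before time [t], so it is uncorrelated with the present
   and future noises; the induction needs all [s >= t] at once. *)
have yeta t : forall s, (t <= s < M)%N -> has_mean_mx (fun o => y t o *m (eta s o)^T) 0.
  elim: t => [|t ih] s /andP[ts sM]; first exact: y0eta.
  under eq_fun do rewrite yE ?(ltn_trans ts sM)// mulmxDl -mulmxA.
  rewrite -[0]addr0; apply: has_mean_mxD; last by apply: etaeta; rewrite ts.
  by rewrite -(mulmx0 _ (F t)); apply: has_mean_mxMl; apply: ih; rewrite ltnW.
elim=> [//|t ih tM] /=.
under eq_fun do rewrite yE//.
apply: has_second_momentD; last exact: etaW.
  by apply/has_second_momentMl/ih/ltnW.
under eq_fun do rewrite -mulmxA.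
by rewrite -(mulmx0 _ (F t)); apply/has_mean_mxMl/yeta; rewrite leqnn.
Qed.

End matrix_means.

(** * First and second moments of centred normal vectors *)

Section normal_vectors.
Context (R : realType) (d : measure_display) (Omega : measurableType d).
Variable P : probability Omega R.

Lemma random_vector_outer (p q : nat) (X : Omega -> 'cV[R]_p) (Y : Omega -> 'cV[R]_q) i j :
  random_vector X -> random_vector Y ->
  measurable_fun setT (fun o => (X o *m (Y o)^T) i j).
Proof.
move=> mX mY; under eq_fun do rewrite mxE big_ord1 !mxE.
exact: measurable_funM.
Qed.

Lemma random_vector_functional (n : nat) (X : Omega -> 'cV[R]_n) (a : 'cV[R]_n) :
  random_vector X -> measurable_fun setT (fun o => (a^T *m X o) 0 0).
Proof.
move=> mX; under eq_fun do rewrite mxE.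
by apply: measurable_sum => i; exact: measurable_funM.
Qed.

Lemma normal_vector_functional_sqr (n : nat) (X : Omega -> 'cV[R]_n) S (a : 'cV[R]_n) :
  normal_vector P X 0 S -> has_mean P (fun o => (a^T *m X o) 0 0 ^+ 2) (bform a S a).
Proof.
move=> [mX [_ S0] XS]; have maX := random_vector_functional a mX.
apply: has_meanP; first exact: measurable_funX.
pose f o : measurableTypeR R := (a^T *m X o) 0 0.
have mf : measurable_fun setT f by exact: maX.
pose Y : {RV P >-> measurableTypeR R} :=
  HB.pack f (isMeasurableFun.Build _ _ _ _ f mf).
have msqr : measurable_fun setT (fun x : measurableTypeR R => (x ^+ 2)%:E).
  by apply: measurableT_comp => //; exact: exprn_measurable.
rewrite -[LHS](@ge0_integral_distribution _ _ _ _ _ P Y (fun x => (x ^+ 2)%:E))//; last first.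
  by move=> x; rewrite lee_fin sqr_ge0.
have law B : measurable B -> distribution P Y B = normal_law 0 (bform a S a) B.
  by move=> mB; have := XS a B mB; rewrite mulmx0 mxE.
(* A functional of variance zero follows a point mass and is treated apart. *)
have [v0|v0] := eqVneq (bform a S a) 0.
  rewrite (eq_measure_integral \d_(0 : measurableTypeR R)) => [|B mB _]; last first.
    by apply: (eq_trans (law B mB)); rewrite /normal_law v0 eqxx.
  by rewrite integral_dirac//= diracT mul1e expr0n v0.
transitivity (\int[normal_prob 0 (Num.sqrt (bform a S a))]_x (x ^+ 2)%:E)%E.
  apply: eq_measure_integral => B mB _.
  by apply: (eq_trans (law B mB)); rewrite /normal_law (negbTE v0).
rewrite normal_prob_second_moment ?sqr_sqrtr//.
by rewrite sqrtr_gt0 lt_neqAle eq_sym v0 S0.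
Qed.

(** Polarisation: [X_i X_j] is half of [(X_i + X_j)^2 - X_i^2 - X_j^2], and each square is that of a
    linear functional of [X]. *)
Lemma normal_vector_second_moment (n : nat) (X : Omega -> 'cV[R]_n) S :
  normal_vector P X 0 S -> has_mean_mx P (fun o => X o *m (X o)^T) S.
Proof.
move=> XS i j; have [_ [St _] _] := XS.
pose e k : 'cV[R]_n := delta_mx k 0.
have XE k o : ((e k)^T *m X o) 0 0 = X o k 0.
  by rewrite trmx_delta -rowE mxE.
have SE k l : ((e k)^T *m S *m e l) 0 0 = S k l.
  by rewrite trmx_delta -rowE -colE !mxE.
have ab := normal_vector_functional_sqr (e i + e j) XS.
have aa := has_meanZ (-1) (normal_vector_functional_sqr (e i) XS).
have bb := has_meanZ (-1) (normal_vector_functional_sqr (e j) XS).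
have := has_meanZ (2^-1) (has_meanD ab (has_meanD aa bb)).
congr has_mean.
  apply/funext => o; rewrite linearD/= !mulmxDl mxE !XE !mxE big_ord1 !mxE.
  by field.
have SC : S j i = S i j by rewrite -[in LHS]St mxE.
have bformD (x y : 'cV[R]_n) : bform (x + y) S (x + y) =
    (x^T *m S *m x) 0 0 + (y^T *m S *m x) 0 0 +
    ((x^T *m S *m y) 0 0 + (y^T *m S *m y) 0 0).
  by rewrite /bform mulmxDr [(x + y)^T]linearD/= !mulmxDl !mxE.
by rewrite bformD /bform !SE SC; field.
Qed.

(* [X] and [- X] have the same law. *)
Lemma normal_vector_mean0 (n : nat) (X : Omega -> 'cV[R]_n) S :
  normal_vector P X 0 S -> has_mean_mx P X 0.
Proof.
move=> XS i j; rewrite (ord1 j).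
have [mX _ law] := XS.
have [b Xb] := has_second_moment_mean mX (normal_vector_second_moment XS).
have [Xi Xc] := Xb i 0; set c := b i 0 in Xc.
suff -> : (0 : 'M[R]_(n, 1)) i 0 = c by [].
have mXN : measurable_fun setT (fun o => - X o i 0) by exact: measurableT_comp.
pose Y : {RV P >-> R} := 
  HB.pack (fun o => X o i 0) (isMeasurableFun.Build _ _ _ _ _ (mX i)).
pose Z : {RV P >-> R} := 
  HB.pack (fun o => - X o i 0) (isMeasurableFun.Build _ _ _ _ _ mXN).
have YZ B : measurable B -> distribution P Y B = distribution P Z B.
  move=> mB; pose e : 'cV[R]_n := delta_mx i 0.
  have eX o : (e^T *m X o) 0 0 = X o i 0 by rewrite trmx_delta -rowE mxE.
  (* The variance is even in the functional and the mean is zero, so [e] and [- e] give the same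
     law. *)
  have eS : bform (- e) S (- e) = bform e S e.
    by rewrite /bform mulmxN [(- e)^T]linearN/= !mulNmx opprK.
  have := law (- e) B mB; rewrite eS !mulmx0 -(mulmx0 _ e^T) -law//.
  rewrite [(- e)^T]linearN/=; under eq_set do rewrite mulNmx mxE eX.
  by under [in X in _ = X -> _]eq_set do rewrite eX.
have Zi : P.-integrable setT (EFin \o Z) by exact: integrableN Xi.
have : c%:E = (- c)%:E.
  rewrite EFinN -Xc -integralN ?integrable_add_def//.
  rewrite -[LHS](@integral_distribution _ _ _ _ _ P Y EFin)//.
  rewrite -[RHS](@integral_distribution _ _ _ _ _ P Z EFin)//.
  by apply: eq_measure_integral => B mB _; exact: YZ.
by move=> [cN]; rewrite mxE; lra.
Qed.

End normal_vectors.

(** * From mutual independence to uncorrelated vectors *)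

Section independence.
Context (R : realType) (d : measure_display) (Omega : measurableType d).
Variable P : probability Omega R.

Lemma sigma_of_preimage (n : nat) (X : Omega -> 'cV[R]_n) (i : 'I_n) (B : set R) :
  measurable B -> sigma_of X ((fun o => X o i 0) @^-1` B).
Proof.
move=> mB; apply: sub_sigma_algebra; rewrite (bigD1 i)//=; left.
by exists B => //; rewrite setTI.
Qed.

Lemma mutually_independent2 (I : choiceType) (F : I -> set (set Omega)) (k l : I) A B :
  mutually_independent P F -> k != l -> F k A -> F l B ->
  (P (A `&` B) = P A * P B)%E.
Proof.
move=> indep kl FA FB.
have := indep [fset k; l]%fset (fun i => if i == k then A else B).
rewrite big_fsetU1 ?inE//= big_seq_fset1 eqxx eq_sym (negbTE kl) => ind; rewrite -ind.
  congr (P _); apply/seteqP; split.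
    move=> o [Ao Bo] i /=; rewrite !inE => /orP[] /eqP->; rewrite ?eqxx//.
    by rewrite eq_sym (negbTE kl).
  move=> o h; split; first by have := h k; rewrite /= !inE eqxx; apply.
  by have := h l; rewrite /= !inE eqxx orbT eq_sym (negbTE kl); apply.
by move=> i; rewrite !inE => /orP[] /eqP->; rewrite ?eqxx// eq_sym (negbTE kl).
Qed.

(** Each entry of [X Y^T] is a product of two independent coordinates. The sigma-algebras enter
    through equations so that one index type can cover vectors of different dimensions. *)
Lemma has_mean_outer_indep (I : choiceType) (F : I -> set (set Omega)) (k l : I)
    (p q : nat) (X : Omega -> 'cV[R]_p) (Y : Omega -> 'cV[R]_q) a b :
  mutually_independent P F -> k != l -> F k = sigma_of X -> F l = sigma_of Y ->
  random_vector X -> random_vector Y -> has_mean_mx P X a -> has_mean_mx P Y b ->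
  has_mean_mx P (fun o => X o *m (Y o)^T) (a *m b^T).
Proof.
move=> indep kl FX FY mX mY Xa Yb i j.
rewrite mxE big_ord1 mxE; under eq_fun do rewrite mxE big_ord1 mxE.
apply: has_meanM => // A B mA mB.
apply: (mutually_independent2 indep kl).
  by rewrite FX; exact: sigma_of_preimage.
by rewrite FY; exact: sigma_of_preimage.
Qed.

End independence.

(** * Duality of the two covariance recursions, and quadratic forms as traces *)

Section algebra.
Context (R : realType).

(** [T] runs through the transposed matrices [F] in reverse order, so it is the adjoint of the
    recursion for [Pi]: cyclicity of the trace moves one factor [F] from [Pi] to [T] at each
    step. *)
Lemma lin_cov_duality (n M : nat) (F G : nat -> 'M[R]_n) (P0 S : 'M[R]_n) :
  (0 < M)%N ->
  let T := lin_cov (fun t => (F (M - t - 1)%N)^T)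
                   (fun t => if (t.+1 < M)%N then S else 0) S in
  \sum_(t < M) \tr (lin_cov F G P0 t.+1 *m S) =
  \sum_(t < M) \tr (G (M - t - 1)%N *m T t) + \tr (P0 *m T M).
Proof.
move=> M0 T; pose Pi := lin_cov F G P0.
(* After [k] steps, [k] noise terms are split off, a mixed term pairs [Pi (M - k)] with [T k], and
   the terms not yet absorbed remain. At [k = 0] the mixed term is the last summand; at [k = M]
   truncated subtraction empties the remainder. *)
have tele k : (k <= M)%N -> \sum_(t < M) \tr (Pi t.+1 *m S) =
    \sum_(t < k) \tr (G (M - t - 1)%N *m T t) + \tr (Pi (M - k)%N *m T k) +
    \sum_(t < M - k - 1) \tr (Pi t.+1 *m S).
  elim: k => [_|k ih kM].
    rewrite big_ord0 add0r subn0 subn1; case: M M0 @T => // m _ T.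
    by rewrite big_ord_recr/= addrC.
  rewrite ih 1?ltnW// big_ord_recr/= -!addrA; congr (_ + _).
  have [j Mj] : exists j, M = (k + j.+1)%N by exists (M - k.+1)%N; lia.
  have TE : T k.+1 = (F j)^T *m T k *m F j + (if (0 < j)%N then S else 0).
    rewrite /T /= -/T trmxK (_ : M - k - 1 = j)%N; last lia.
    by rewrite (_ : (k.+1 < M)%N = (0 < j)%N)//; lia.
  have PiE : Pi j.+1 = F j *m Pi j *m (F j)^T + G j by [].
  rewrite TE (_ : M - k - 1 = j)%N; last lia.
  rewrite (_ : M - k.+1 = j)%N; last lia.
  rewrite (_ : M - k = j.+1)%N; last lia.
  rewrite PiE mulmxDl mxtraceD [X in X + _ = _]addrC -addrA; congr (_ + _).
  rewrite mulmxDr mxtraceD -addrA.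
  have -> : \tr (F j *m Pi j *m (F j)^T *m T k) = \tr (Pi j *m ((F j)^T *m T k *m F j)).
    by rewrite -!mulmxA mxtrace_mulC !mulmxA.
  (* For [j > 0] the [S] added to [T] absorbs the last remaining summand [tr (Pi j S)]. At [j = 0]
     nothing is added and nothing remains. *)
  congr (_ + _); case: j {Mj TE PiE} => [|j] /=.
    by rewrite !big_ord0 mulmx0 mxtrace0 addr0.
  by rewrite big_ord_recr/= subn1 addrC.
by rewrite (tele M)// subnn big_ord0 addr0.
Qed.

(** In this form the mean of a quadratic cost is read off from the second moment of the vector. *)
Lemma bformE (n p : nat) (x : 'cV[R]_n) (B : 'M[R]_(n, p)) (y : 'cV[R]_p) :
  bform x B y = \tr (B *m (y *m x^T)).
Proof. by rewrite mulmxA mxtrace_mulC mulmxA /bform /mxtrace big_ord1. Qed.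

Lemma bform_Ml (n p : nat) (L : 'M[R]_(n, p)) (S : 'M[R]_p) (x : 'cV[R]_n) :
  bform (L^T *m x) S (L^T *m x) = bform x (L *m S *m L^T) x.
Proof. by rewrite /bform trmx_mul trmxK !mulmxA. Qed.

(* The cross term of the control cost completes the square of [s + C^T u]. *)
Lemma stage_cost_square (n p : nat) (C : 'M[R]_(p, n)) (S : 'M[R]_n) (V : 'M[R]_p)
    (s : 'cV[R]_n) (u : 'cV[R]_p) : S^T = S ->
  bform s S s + bform u (C *m S *m C^T + V) u + 2 * bform u (C *m S) s =
  bform (s + C^T *m u) S (s + C^T *m u) + bform u V u.
Proof.
move=> St.
have sym : (s^T *m S *m (C^T *m u)) 0 0 = (u^T *m (C *m S) *m s) 0 0.
  have -> : u^T *m (C *m S) *m s = (s^T *m S *m (C^T *m u))^T.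
    by rewrite !trmx_mul !trmxK St !mulmxA.
  by rewrite [RHS]mxE.
have -> : bform u (C *m S *m C^T + V) u =
    (u^T *m (C *m S *m C^T) *m u) 0 0 + bform u V u.
  by rewrite /bform mulmxDr mulmxDl mxE.
have -> : bform (s + C^T *m u) S (s + C^T *m u) =
    bform s S s + (u^T *m (C *m S) *m s) 0 0 +
    ((s^T *m S *m (C^T *m u)) 0 0 + (u^T *m (C *m S *m C^T) *m u) 0 0).
  rewrite /bform mulmxDr [(s + C^T *m u)^T]linearD/= trmx_mul trmxK.
  by rewrite !mulmxDl !mulmxA !mxE.
rewrite sym /bform; ring.
Qed.

End algebra.

(** * Closed forms of the estimation cost and of the control cost *)

Section costs.
Context (R : realType) (M N m : nat) (A : 'M[R]_N) (C : 'M[R]_(m, N)).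
Context (Q : nat -> 'M[R]_N) (V : nat -> 'M[R]_m) (P0 : 'M[R]_N).
Context (d : measure_display) (Omega : measurableType d).
Variable P : probability Omega R.
Variable K : M.-tuple 'M[R]_(N, m).

(** The measurement update of the filter: the new error is [correction t] applied to [A e_t + w_t],
    minus [K_t v_(t+1)]. *)
Definition correction t : 'M[R]_N := 1%:M - K`_t *m C.
Definition error_transition t : 'M[R]_N := correction t *m A.
(** The sign of [- K_t] is kept so that both summands have the shape [L B L^T] used by
    [has_second_momentMl] and [bform_Ml]. *)
Definition error_noise_cov t : 'M[R]_N :=
  correction t *m Q t *m (correction t)^T +
  (- K`_t) *m V t.+1 *m (- K`_t)^T.

Lemma estimation_costE (x0 : Omega -> 'cV[R]_N) (xbar0 : 'cV[R]_N)
    (w : nat -> Omega -> 'cV[R]_N) (v : nat -> Omega -> 'cV[R]_m) :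
  random_vector x0 ->
  (forall t, random_vector (w t)) -> (forall t, random_vector (v t)) ->
  (forall t, has_mean_mx P (w t) 0) -> (forall t, has_mean_mx P (v t) 0) ->
  (forall t, has_mean_mx P (fun o => w t o *m (w t o)^T) (Q t)) ->
  (forall t, has_mean_mx P (fun o => v t o *m (v t o)^T) (V t)) ->
  has_mean_mx P (fun o => (x0 o - xbar0) *m (x0 o - xbar0)^T) P0 ->
  mutually_independent P (noise_sigma x0 w v) ->
  estimation_cost A C P x0 xbar0 w v K =
  (\sum_(t < M) \tr (lin_cov error_transition error_noise_cov P0 t.+1 *m SigmaCA A C))%:E.
Proof.
move=> mx0 mw mv w0 v0 ww vv xx indep.
pose e := error A C x0 xbar0 w v K.
pose eta t o := correction t *m w t o + (- K`_t) *m v t.+1 o.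
have eE t o : e t.+1 o = error_transition t *m e t o + eta t o.
  rewrite /e /error /= /eta /error_transition /correction.
  set x := state _ _ _ _ _; set y := estimate _ _ _ _ _ _ _ _ _.
  rewrite -!mulmxA !mulmxBl !mul1mx !mulNmx !mulmxBr !opprD !opprK !mulmxA -!addrA.
  by congr (_ + _); do 2 (rewrite [LHS]addrCA; congr (_ + _)); rewrite [LHS]addrCA.
(* Some mean of [x0] is enough: it will only be multiplied by the zero mean of a noise. *)
have [b x0b] : exists b, has_mean_mx P x0 b.
  have mX : random_vector (fun o => x0 o - xbar0).
    by move=> i; under eq_fun do rewrite !mxE; exact: measurable_funB.
  have [b Xb] := has_second_moment_mean mX xx.
  exists (b + xbar0); have := has_mean_mxD Xb (has_mean_mx_cst P xbar0).
  by congr has_mean_mx; apply/funext => o; rewrite subrK.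
have uncorr k l (p q : nat) (X : Omega -> 'cV[R]_p) (Y : Omega -> 'cV[R]_q) a :
    k != l -> noise_sigma x0 w v k = sigma_of X -> noise_sigma x0 w v l = sigma_of Y ->
    random_vector X -> random_vector Y -> has_mean_mx P X a -> has_mean_mx P Y 0 ->
    has_mean_mx P (fun o => X o *m (Y o)^T) 0.
  move=> kl kX lY mX mY Xa Y0.
  by have := has_mean_outer_indep indep kl kX lY mX mY Xa Y0; rewrite trmx0 mulmx0.
have ww0 s t : s != t -> has_mean_mx P (fun o => w s o *m (w t o)^T) 0.
  move=> st; exact: (uncorr (Some (inl s)) (Some (inl t))).
have vv0 s t : s != t -> has_mean_mx P (fun o => v s o *m (v t o)^T) 0.
  move=> st; exact: (uncorr (Some (inr s)) (Some (inr t))).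
have wv0 s t : has_mean_mx P (fun o => w s o *m (v t o)^T) 0.
  exact: (uncorr (Some (inl s)) (Some (inr t))).
(* Subtracting the constant [xbar0] preserves a zero cross moment with a centred vector. *)
have center (p : nat) (Y : Omega -> 'cV[R]_p) :
    has_mean_mx P (fun o => x0 o *m (Y o)^T) 0 -> has_mean_mx P Y 0 ->
    has_mean_mx P (fun o => (x0 o - xbar0) *m (Y o)^T) 0.
  move=> xY /has_mean_mxT/(has_mean_mxMl (- xbar0)) => /(has_mean_mxD xY).
  rewrite trmx0 mulmx0 addr0; congr has_mean_mx.
  by apply/funext => o; rewrite mulmxDl.
have xw t : has_mean_mx P (fun o => (x0 o - xbar0) *m (w t o)^T) 0.
  by apply: center => //; exact: (uncorr None (Some (inl t)) _ _ _ _ _ isT).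
have xv t : has_mean_mx P (fun o => (x0 o - xbar0) *m (v t o)^T) 0.
  by apply: center => //; exact: (uncorr None (Some (inr t)) _ _ _ _ _ isT).
(* [eta t] involves [w t] and [v t.+1], so different times use different noises; the four cross
   moments vanish separately. *)
have eta0 s t : (s < t)%N -> has_mean_mx P (fun o => eta s o *m (eta t o)^T) 0.
  move=> st; have st' : s != t by rewrite ltn_eqF.
  apply: has_mean_outer0_lin; apply: has_mean_outer0_sym;
    apply: has_mean_outer0_lin; apply: has_mean_outer0_sym.
  - exact: ww0.
  - exact/has_mean_outer0_sym.
  - exact: wv0.
  - exact: vv0.
have etaG t : has_mean_mx P (fun o => eta t o *m (eta t o)^T) (error_noise_cov t).
  apply: has_second_momentD; [exact: has_second_momentMl| |exact: has_second_momentMl].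
  have := has_mean_mxMl (correction t) (has_mean_mxMr (- K`_t)^T (wv0 t t.+1)).
  rewrite mul0mx mulmx0; congr has_mean_mx; apply/funext => o.
  by rewrite trmx_mul !mulmxA.
have eP t : (t <= M)%N -> has_mean_mx P (fun o => e t o *m (e t o)^T)
    (lin_cov error_transition error_noise_cov P0 t).
  apply: (lin_cov_second_moment (eta := eta)) => //.
  - by move=> s _; apply: has_mean_outer0_lin; [exact: xw|exact: xv].
  - by move=> s u /andP[su _]; exact: eta0.
rewrite /estimation_cost; apply: has_mean_expectation.
rewrite [X in has_mean _ _ X](_ : _ =
    \tr ((\sum_(t < M) lin_cov error_transition error_noise_cov P0 t.+1) *m
      SigmaCA A C)); last first.
  by rewrite mulmx_suml raddf_sum.
by apply/has_mean_trace/has_mean_mxMr/has_mean_mx_sum => t; exact: eP.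
Qed.

Lemma control_costE (s0 : Omega -> 'cV[R]_N) (z : nat -> Omega -> 'cV[R]_N) :
  (forall t, (Q t)^T = Q t) ->
  normal_vector P s0 0 (SigmaCA A C) ->
  (forall t, (t.+1 < M)%N -> normal_vector P (z t) 0 (SigmaCA A C)) ->
  (forall o, z M.-1 o = 0) ->
  mutually_independent P (control_noise_sigma (M := M) s0 z) ->
  let T := lin_cov (fun t => (error_transition (M - t - 1)%N)^T)
                   (fun t => if (t.+1 < M)%N then SigmaCA A C else 0) (SigmaCA A C) in
  control_cost A C Q V P0 P s0 z K =
  (\sum_(t < M) \tr (error_noise_cov (M - t - 1)%N *m T t) + \tr (P0 *m T M))%:E.
Proof.
move=> Qt s0N zN zlast indep T.
pose s := control_state A C s0 z K.
(* The only index below [M] with [t.+1 < M] false is [M.-1], where the noise is zero. *)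
have z_last t : (t < M)%N -> ~~ (t.+1 < M)%N -> z t = fun=> 0.
  by move=> tM tM'; apply/funext => o; rewrite (_ : t = M.-1) ?zlast//; lia.
have z_rv t : (t < M)%N -> random_vector (z t).
  move=> tM; have [/zN[]//|/z_last->// i] := boolP (t.+1 < M)%N.
have z_mean t : (t < M)%N -> has_mean_mx P (z t) 0.
  move=> tM; have [/zN/normal_vector_mean0//|/z_last->//] := boolP (t.+1 < M)%N.
  exact: has_mean_mx_cst.
have zz t : (t < M)%N -> has_mean_mx P (fun o => z t o *m (z t o)^T)
    (if (t.+1 < M)%N then SigmaCA A C else 0).
  move=> tM; have [/zN/normal_vector_second_moment//|/z_last->//] := boolP (t.+1 < M)%N.
  by rewrite mul0mx; exact: has_mean_mx_cst.
have sP t : (t <= M)%N -> has_mean_mx P (fun o => s t o *m (s t o)^T) (T t).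
  apply: (lin_cov_second_moment (eta := z)) => //.
  (* Closing the loop turns [A^T - (C A)^T K^T] into the transpose of [(I - K C) A], the error
     transition at the reversed time. *)
  - move=> {}t o _; rewrite /s /= /feedback -/(s t o); congr (_ + _).
    rewrite /error_transition /correction mulmxBl mul1mx.
    rewrite [(A - _)^T]linearB/= mulmxBl !mulNmx mulmxN.
    by rewrite !trmx_mul !mulmxA.
  - exact: normal_vector_second_moment s0N.
  - move=> {}t tM; have [ms0 _ _] := s0N.
    have := has_mean_outer_indep (k := None) (l := Some (Ordinal tM)) indep isT erefl erefl
      ms0 (z_rv t tM) (normal_vector_mean0 s0N) (z_mean t tM).
    by rewrite trmx0 mulmx0.
  - move=> r {}t /andP[rt tM]; have rM := ltn_trans rt tM.
    have rt' : Some (Ordinal rM) != Some (Ordinal tM).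
      by apply/eqP => -[E]; rewrite E ltnn in rt.
    have := has_mean_outer_indep indep rt' erefl erefl
      (z_rv r rM) (z_rv t tM) (z_mean r rM) (z_mean t tM).
    by rewrite trmx0 mulmx0.
rewrite /control_cost; apply: has_mean_expectation.
have := has_meanD (has_mean_sum (index_enum 'I_M) (fun t : 'I_M =>
    has_mean_trace (has_mean_mxMl (error_noise_cov (M - t - 1)%N) (sP t (ltnW (ltn_ord t))))))
  (has_mean_trace (has_mean_mxMl P0 (sP M (leqnn M)))).
congr has_mean; apply/funext => o; rewrite -bformE; congr (_ + _).
(* With [u = - K^T s] the completed square [s + C^T u] equals [(I - K C)^T s], so the stage cost is
   the quadratic form of [error_noise_cov] at [s]. *)
apply: eq_bigr => t _; rewrite stage_cost_square// -bformE.
rewrite /control_input /feedback -/(s t o).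
(* With [k = M - t - 1], the weight [V (M - t)] is [V k.+1], the covariance of the measurement noise
   paired with [K_k]. *)
have : (M - t = (M - t - 1).+1)%N by have := ltn_ord t; lia.
move: (M - t - 1)%N => k ->.
have -> : - (K`_k)^T *m s t o = (- K`_k)^T *m s t o by rewrite [(- _)^T]linearN.
have -> : s t o + C^T *m ((- K`_k)^T *m s t o) = (correction k)^T *m s t o.
  rewrite /correction [(1%:M - _)^T]linearB [(- _)^T]linearN/= trmx1 mulmxBl mul1mx mulNmx mulmxN.
  by rewrite trmx_mul mulmxA.
by rewrite !bform_Ml /error_noise_cov /bform mulmxDr mulmxDl mxE.
Qed.

End costs.

(** * Equality of the two costs and transfer of minimality *)

Theorem theorem1 (R : realType) (M N m : nat)
  (M_gt0 : (0 < M)%N) (N_gt0 : (0 < N)%N) (m_gt0 : (0 < m)%N)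
  (A : 'M[R]_N) (C : 'M[R]_(m, N))
  (* the system *)
  (d : measure_display) (Omega : measurableType d) (P : probability Omega R)
  (x0 : Omega -> 'cV[R]_N) (xbar0 : 'cV[R]_N) (Sigma_x0 : 'M[R]_N)
  (w : nat -> Omega -> 'cV[R]_N) (v : nat -> Omega -> 'cV[R]_m)
  (Q : nat -> 'M[R]_N) (V : nat -> 'M[R]_m)
  (x0_normal : normal_vector P x0 xbar0 Sigma_x0)
  (w_gaussian : forall t, gaussian P (w t))
  (w_mean : forall t, has_expectation P (w t) 0)
  (w_cov : forall t, has_expectation P (fun o => w t o *m (w t o)^T) (Q t))
  (v_gaussian : forall t, gaussian P (v t))
  (v_mean : forall t, has_expectation P (v t) 0)
  (v_cov : forall t, has_expectation P (fun o => v t o *m (v t o)^T) (V t))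
  (noise_indep : mutually_independent P (noise_sigma x0 w v))
  (Q_posdef : forall t, pos_def (Q t))
  (V_posdef : forall t, pos_def (V t))
  (* P_0 = E[(x_0 - xhat_0)(x_0 - xhat_0)^T], where xhat_0 = xbar_0 *)
  (P0 : 'M[R]_N)
  (P0E : has_expectation P
           (fun o => (x0 o - xbar0) *m (x0 o - xbar0)^T) P0)
  (* the noises of the control problem *)
  (d' : measure_display) (Omega' : measurableType d')
  (P' : probability Omega' R)
  (s0 : Omega' -> 'cV[R]_N) (z : nat -> Omega' -> 'cV[R]_N)
  (s0_normal : normal_vector P' s0 0 (SigmaCA A C))
  (z_normal : forall t, (t.+1 < M)%N -> normal_vector P' (z t) 0 (SigmaCA A C))
  (z_last : forall o, z M.-1 o = 0)
  (control_indep :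
    mutually_independent P' (control_noise_sigma (M := M) s0 z))
  (K : M.-tuple 'M[R]_(N, m)) :
  is_minimizer (estimation_cost A C P x0 xbar0 w v) K <->
  is_minimizer (control_cost A C Q V P0 P' s0 z) K.
Proof.
have w_rv t : random_vector (w t) by have [mu [S []]] := w_gaussian t.
have v_rv t : random_vector (v t) by have [mu [S []]] := v_gaussian t.
have x0_rv : random_vector x0 by have [] := x0_normal.
have x0c_rv : random_vector (fun o => x0 o - xbar0).
  by move=> i; under eq_fun do rewrite !mxE; exact: measurable_funB.
suff JE : forall K' : M.-tuple 'M[R]_(N, m),
    estimation_cost A C P x0 xbar0 w v K' =
    control_cost A C Q V P0 P' s0 z K'.
  by split=> Kmin K'; [rewrite -!JE|rewrite !JE]; exact: Kmin.
move=> K'; rewrite (estimation_costE A C (Q := Q) (V := V) (P0 := P0))//; first last.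
- by apply: has_mean_mxP => // i j; exact: random_vector_outer.
- by move=> t; apply: has_mean_mxP => // i j; exact: random_vector_outer.
- by move=> t; apply: has_mean_mxP => // i j; exact: random_vector_outer.
- by move=> t; apply: has_mean_mxP => // i j; rewrite (ord1 j); exact: v_rv.
- by move=> t; apply: has_mean_mxP => // i j; rewrite (ord1 j); exact: w_rv.
rewrite (@control_costE _ _ _ _ A C Q V P0 _ _ P')//; last first.
  by move=> t; have [] := Q_posdef t.
by rewrite lin_cov_duality.
Qed.
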